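(* Let $k_1,k_2>0$ and let $\delta>0$ satisfy $$\delta<\frac1{2L}\min\left(\frac1\eta,\ \frac{2k_1\alpha_1}{\alpha_1\rho+k_1^2},\ \frac{4k_2\beta\alpha_1}{2\alpha_1\beta\mu+(\alpha+\gamma^2\beta)k_2^2}\right).$$ Then, for every $N\in\mathbb N$ with $h=\frac L{N+1}$, the energy $E_h^{\rm ORFD}(t)$ of every solution of the semi-discrete system (S) given in the context decays exponentially: $$E_h^{\rm ORFD}(t)\le\frac{1+\delta L\eta}{1-\delta L\eta}\,e^{-\delta(1-\delta L\eta)t}\,E_h^{\rm ORFD}(0),\qquad t\ge0.$$
   Context: Let $L>0$ and let $\rho,\mu,\alpha,\beta,\gamma$ be positive constants with $\alpha_1:=\alpha-\gamma^2\beta>0$. Put $$\eta:=\max\left(\sqrt{\tfrac{\rho}{\alpha_1}}+\sqrt{\tfrac{\mu\gamma^2}{\alpha_1}},\ \sqrt{\tfrac{\mu}{\beta}}+\sqrt{\tfrac{\mu\gamma^2}{\alpha_1}}\right).$$ For $N\in\mathbb N$ let $h=\frac L{N+1}$ and $x_j=jh$ for $j=0,\dots,N+1$. For a grid function $(U_j)_{j=0}^{N+1}$ write $U_{j+\frac12}:=\frac{U_j+U_{j+1}}2$ and $\delta_x[U_{j+\frac12}]:=\frac{U_{j+1}-U_j}h$ for $j=0,\dots,N$. A dot denotes the time derivative. The semi-discrete system (S), for real-valued grid functions $u^1_j(t),u^2_j(t),w^1_j(t),w^2_j(t)$, $j=0,\dots,N+1$, is $$\begin{cases}\dot u^1_{j+\frac12}-\delta_x[w^1_{j+\frac12}]=0,\\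 \dot u^2_{j+\frac12}-\delta_x[w^2_{j+\frac12}]=0,\\ \rho\,\dot w^1_{j+\frac12}-\alpha\,\delta_x[u^1_{j+\frac12}]+\gamma\beta\,\delta_x[u^2_{j+\frac12}]=0,\\ \mu\,\dot w^2_{j+\frac12}-\beta\,\delta_x[u^2_{j+\frac12}]+\gamma\beta\,\delta_x[u^1_{j+\frac12}]=0,& j=0,\dots,N,\\ w^1_0=w^2_0=0,\\ \alpha u^1_{N+1}-\gamma\beta u^2_{N+1}=-k_1w^1_{N+1},\\ \beta u^2_{N+1}-\gamma\beta u^1_{N+1}=-k_2w^2_{N+1},& t>0,\end{cases}$$ with given initial data $(u^1,u^2,w^1,w^2)_j(0)=(u^1,u^2,w^1,w^2)_j^0$, $j=0,\dots,N+1$. Its energy is $$E_h^{\rm ORFD}(t):=\frac h2\sum_{j=0}^N\left(\rho|w^1_{j+\frac12}|^2+\mu|w^2_{j+\frac12}|^2+\beta|\gamma u^1_{j+\frac12}-u^2_{j+\frac12}|^2+\alpha_1|u^1_{j+\frac12}|^2\right).$$ *)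

(* Defs.v *)
From Stdlib Require Import Reals Lra.
From Coquelicot Require Import Coquelicot.
Open Scope R_scope.

(* A grid function (U_j), j = 0..N+1, is a sequence [nat -> R] of which only
   the entries with index at most N+1 are ever used; a time-dependent grid
   function is [u : nat -> R -> R], index first. *)

Definition mesh (L : R) (N : nat) : R := L / INR (N + 1).

(* [mid U j] is U_{j+1/2}, and [delta_x h U j] is delta_x[U_{j+1/2}]. *)
Definition mid (U : nat -> R) (j : nat) : R := (U j + U (S j)) / 2.

Definition delta_x (h : R) (U : nat -> R) (j : nat) : R := (U (S j) - U j) / h.

Definition at_time (u : nat -> R -> R) (t : R) : nat -> R := fun j => u j t.

Definition dot (u : nat -> R -> R) (t : R) : nat -> R := fun j => Derive (u j) t.

Definition alpha1 (alpha beta gamma : R) : R := alpha - gamma ^ 2 * beta.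

Definition eta (rho mu alpha beta gamma : R) : R :=
  let a1 := alpha1 alpha beta gamma in
  Rmax (sqrt (rho / a1) + sqrt (mu * gamma ^ 2 / a1))
       (sqrt (mu / beta) + sqrt (mu * gamma ^ 2 / a1)).

(* [Derive] is a total operator, so differentiability is demanded separately.
   Continuity on [0, +oo) is what ties the initial data to the evolution for
   t > 0. *)
Definition regular (N : nat) (u : nat -> R -> R) : Prop :=
  forall j : nat, (j <= N + 1)%nat ->
    continuous_on (fun t => 0 <= t) (u j) /\
    (forall t : R, 0 < t -> ex_derive (u j) t).

Record is_solution (L rho mu alpha beta gamma k1 k2 : R) (N : nat)
    (u1_0 u2_0 w1_0 w2_0 : nat -> R) (u1 u2 w1 w2 : nat -> R -> R) : Prop := {
  sol_regular :
    regular N u1 /\ regular N u2 /\ regular N w1 /\ regular N w2;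
  sol_eq_u1 : forall (t : R) (j : nat), 0 < t -> (j <= N)%nat ->
    mid (dot u1 t) j - delta_x (mesh L N) (at_time w1 t) j = 0;
  sol_eq_u2 : forall (t : R) (j : nat), 0 < t -> (j <= N)%nat ->
    mid (dot u2 t) j - delta_x (mesh L N) (at_time w2 t) j = 0;
  sol_eq_w1 : forall (t : R) (j : nat), 0 < t -> (j <= N)%nat ->
    rho * mid (dot w1 t) j
      - alpha * delta_x (mesh L N) (at_time u1 t) j
      + gamma * beta * delta_x (mesh L N) (at_time u2 t) j = 0;
  sol_eq_w2 : forall (t : R) (j : nat), 0 < t -> (j <= N)%nat ->
    mu * mid (dot w2 t) j
      - beta * delta_x (mesh L N) (at_time u2 t) j
      + gamma * beta * delta_x (mesh L N) (at_time u1 t) j = 0;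
  sol_left : forall t : R, 0 < t -> w1 0%nat t = 0 /\ w2 0%nat t = 0;
  sol_right1 : forall t : R, 0 < t ->
    alpha * u1 (N + 1)%nat t - gamma * beta * u2 (N + 1)%nat t
      = - k1 * w1 (N + 1)%nat t;
  sol_right2 : forall t : R, 0 < t ->
    beta * u2 (N + 1)%nat t - gamma * beta * u1 (N + 1)%nat t
      = - k2 * w2 (N + 1)%nat t;
  sol_init : forall j : nat, (j <= N + 1)%nat ->
    u1 j 0 = u1_0 j /\ u2 j 0 = u2_0 j /\ w1 j 0 = w1_0 j /\ w2 j 0 = w2_0 j
}.

(* [sum_f_R0 f N] is f 0 + ... + f N, with N+1 terms. *)
Definition energy (L rho mu alpha beta gamma : R) (N : nat)
    (u1 u2 w1 w2 : nat -> R -> R) (t : R) : R :=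
  mesh L N / 2 *
  sum_f_R0 (fun j =>
      rho * Rabs (mid (at_time w1 t) j) ^ 2
    + mu * Rabs (mid (at_time w2 t) j) ^ 2
    + beta * Rabs (gamma * mid (at_time u1 t) j - mid (at_time u2 t) j) ^ 2
    + alpha1 alpha beta gamma * Rabs (mid (at_time u1 t) j) ^ 2) N.

(* Main.v *)
Require Import Defs.
From Stdlib Require Import Reals Lra Lia.
From Coquelicot Require Import Coquelicot.
Open Scope R_scope.

(** The proof perturbs the energy [E = h/2 * sum_j e_(j+1/2)] by the multiplier functional
    [F = h * sum_j x_(j+1/2) (rho w1 u1 + mu w2 u2)_(j+1/2)].  Averages and
    differences satisfy the exact product rule
    [delta_x (U V) = mid U * delta_x V + mid V * delta_x U], so [E'] telescopes
    to [- k1 w1(L)^2 - k2 w2(L)^2] and, by convexity of the density [e],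
    [F' <= L/2 * e(L) - E].  The smallness of [delta] makes the boundary terms
    of [(E + delta F)'] nonpositive, whence [(E + delta F)' <= - delta E];
    since [|F| <= L eta E], Gronwall's inequality concludes. *)

(** * Pointwise estimates for the quadratic forms *)

(** In this form and the next two, [a b c d] stand for values of [u1 u2 w1 w2], taken at a node or
    at a midpoint. The factor 1/2 of the energy is left outside. *)
Definition density (rho mu alpha beta gamma a b c d : R) : R :=
  rho * c ^ 2 + mu * d ^ 2 + beta * (gamma * a - b) ^ 2
  + alpha1 alpha beta gamma * a ^ 2.

Definition multiplier (rho mu a b c d : R) : R := rho * (c * a) + mu * (d * b).

(** Power, that is stress times velocity: the differences of this quantity between neighbouring
    nodes make up the derivative of the energy. *)
Definition flux (alpha beta gamma a b c d : R) : R :=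
  (alpha * a - gamma * beta * b) * c + (beta * b - gamma * beta * a) * d.

Lemma density_ge0 (rho mu alpha beta gamma a b c d : R) :
  0 < rho -> 0 < mu -> 0 < beta -> 0 < alpha1 alpha beta gamma ->
  0 <= density rho mu alpha beta gamma a b c d.
Proof.
  intros Hr Hm Hb Ha; unfold density.
  pose proof (Rmult_le_pos _ _ (Rlt_le _ _ Hr) (pow2_ge_0 c)).
  pose proof (Rmult_le_pos _ _ (Rlt_le _ _ Hm) (pow2_ge_0 d)).
  pose proof (Rmult_le_pos _ _ (Rlt_le _ _ Hb) (pow2_ge_0 (gamma * a - b))).
  pose proof (Rmult_le_pos _ _ (Rlt_le _ _ Ha) (pow2_ge_0 a)).
  lra.
Qed.

Lemma eta_gt0 (rho mu alpha beta gamma : R) :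
  0 < rho -> 0 < alpha1 alpha beta gamma ->
  0 < eta rho mu alpha beta gamma.
Proof.
  intros Hr Ha; unfold eta.
  apply Rlt_le_trans with (2 := Rmax_l _ _).
  pose proof (sqrt_lt_R0 _ (Rdiv_lt_0_compat _ _ Hr Ha)).
  pose proof (sqrt_pos (mu * gamma ^ 2 / alpha1 alpha beta gamma)).
  lra.
Qed.

(** With [s = sqrt (r / q)], so that [r = s * s * q], expand [s * q * (s * x - y) ^ 2 >= 0] and the
    same with a plus sign. Constants of this shape are the square roots that occur in [eta]. *)
Lemma weighted_am_gm (r q x y : R) :
  0 <= r -> 0 < q -> Rabs (r * (x * y)) <= sqrt (r / q) / 2 * (r * x ^ 2 + q * y ^ 2).
Proof.
  intros Hr Hq.
  assert (H0 : 0 <= r / q) by (apply Rcomplements.Rdiv_le_0_compat; lra).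
  pose proof (sqrt_pos (r / q)) as Hs.
  pose proof (sqrt_sqrt _ H0) as Hss.
  set (s := sqrt (r / q)) in *.
  assert (E : r = s * s * q) by (rewrite Hss; field; lra).
  rewrite E.
  assert (Hsq : 0 <= s * q) by (apply Rmult_le_pos; lra).
  pose proof (Rmult_le_pos _ _ Hsq (pow2_ge_0 (s * x - y))).
  pose proof (Rmult_le_pos _ _ Hsq (pow2_ge_0 (s * x + y))).
  apply Rabs_le; split; nra.
Qed.

(** Writing [b = gamma * a - (gamma * a - b)] splits the multiplier into three products, each
    pairing a velocity with a quantity whose square occurs in [density]. After the weighted
    inequalities, the four squares carry the coefficients [s1], [s2 + s3], [s2], [s1 + s3], all at
    most [eta]. *)
Lemma multiplier_bound (rho mu alpha beta gamma a b c d : R) :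
  0 < rho -> 0 < mu -> 0 < beta -> 0 < gamma -> 0 < alpha1 alpha beta gamma ->
  Rabs (multiplier rho mu a b c d)
  <= eta rho mu alpha beta gamma / 2 * density rho mu alpha beta gamma a b c d.
Proof.
  intros Hr Hm Hb Hg Ha.
  assert (Hmg : 0 <= mu * gamma ^ 2) by (apply Rmult_le_pos; [lra | apply pow2_ge_0]).
  pose proof (weighted_am_gm rho _ c a (Rlt_le _ _ Hr) Ha) as H1.
  pose proof (weighted_am_gm mu _ d (gamma * a - b) (Rlt_le _ _ Hm) Hb) as H2.
  (* The rescaled variable [d / gamma] keeps the square term equal to [mu * d ^ 2], while the weight
     [mu * gamma ^ 2] yields the second square root in both entries of [eta]. *)
  pose proof (weighted_am_gm (mu * gamma ^ 2) _ (d / gamma) a Hmg Ha) as H3.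
  replace (mu * gamma ^ 2 * (d / gamma * a)) with (mu * (d * (gamma * a))) in H3
    by (field; lra).
  replace (mu * gamma ^ 2 * (d / gamma) ^ 2) with (mu * d ^ 2) in H3 by (field; lra).
  apply Rle_trans with (1 := Rabs_triang _ _).
  replace (mu * (d * b)) with (mu * (d * (gamma * a)) - mu * (d * (gamma * a - b))) by ring.
  pose proof (Rabs_triang (mu * (d * (gamma * a))) (- (mu * (d * (gamma * a - b))))) as H4.
  rewrite Rabs_Ropp in H4.
  fold (mu * (d * (gamma * a)) - mu * (d * (gamma * a - b))) in H4.
  pose proof (Rmax_l (sqrt (rho / alpha1 alpha beta gamma)
                      + sqrt (mu * gamma ^ 2 / alpha1 alpha beta gamma))
                     (sqrt (mu / beta)
                      + sqrt (mu * gamma ^ 2 / alpha1 alpha beta gamma))) as M1.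
  pose proof (Rmax_r (sqrt (rho / alpha1 alpha beta gamma)
                      + sqrt (mu * gamma ^ 2 / alpha1 alpha beta gamma))
                     (sqrt (mu / beta)
                      + sqrt (mu * gamma ^ 2 / alpha1 alpha beta gamma))) as M2.
  unfold eta, density.
  set (m := Rmax _ _) in *.
  set (s1 := sqrt (rho / _)) in *.
  set (s2 := sqrt (mu / _)) in *.
  set (s3 := sqrt (mu * gamma ^ 2 / _)) in *.
  assert (P1 : 0 <= s1) by apply sqrt_pos.
  assert (P2 : 0 <= s2) by apply sqrt_pos.
  assert (P3 : 0 <= s3) by apply sqrt_pos.
  pose proof (Rmult_le_pos _ _ (Rlt_le _ _ Hr) (pow2_ge_0 c)) as Q1.
  pose proof (Rmult_le_pos _ _ (Rlt_le _ _ Hm) (pow2_ge_0 d)) as Q2.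
  pose proof (Rmult_le_pos _ _ (Rlt_le _ _ Hb) (pow2_ge_0 (gamma * a - b))) as Q3.
  pose proof (Rmult_le_pos _ _ (Rlt_le _ _ Ha) (pow2_ge_0 a)) as Q4.
  set (X1 := rho * c ^ 2) in *.
  set (X2 := mu * d ^ 2) in *.
  set (X3 := beta * (gamma * a - b) ^ 2) in *.
  set (X4 := alpha1 alpha beta gamma * a ^ 2) in *.
  assert (R1 : s1 * X1 <= m * X1) by (apply Rmult_le_compat_r; lra).
  assert (R2 : (s2 + s3) * X2 <= m * X2) by (apply Rmult_le_compat_r; lra).
  assert (R3 : s2 * X3 <= m * X3) by (apply Rmult_le_compat_r; lra).
  assert (R4 : (s1 + s3) * X4 <= m * X4) by (apply Rmult_le_compat_r; lra).
  lra.
Qed.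

Lemma eq_div_of_mul_eq (x y z : R) : y <> 0 -> y * x = z -> x = z / y.
Proof. intros Hy <-; field; exact Hy. Qed.

(* With [p, q] the two boundary stresses, the quadratic form of the
   displacements is [(beta p^2 + 2 gamma beta p q + alpha q^2) / (beta alpha1)],
   and [2 gamma p q <= p^2 + gamma^2 q^2]. *)
Lemma boundary_density_le (rho mu alpha beta gamma k1 k2 a b c d : R) :
  0 < beta -> 0 < alpha1 alpha beta gamma ->
  alpha * a - gamma * beta * b = - k1 * c ->
  beta * b - gamma * beta * a = - k2 * d ->
  density rho mu alpha beta gamma a b c d
  <= (rho + 2 * k1 ^ 2 / alpha1 alpha beta gamma) * c ^ 2
     + (mu + (alpha + gamma ^ 2 * beta) * k2 ^ 2
             / (beta * alpha1 alpha beta gamma)) * d ^ 2.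
Proof.
  intros Hb Ha Hp Hq.
  unfold density; set (A := alpha1 alpha beta gamma) in *.
  assert (EA : alpha = A + gamma ^ 2 * beta) by (unfold A, alpha1; ring).
  (* Adding [gamma] times the second stress to the first eliminates [b]. *)
  assert (Ea : a = (- k1 * c - gamma * (k2 * d)) / A).
  { apply eq_div_of_mul_eq; [lra |].
    replace (A * a) with (alpha * a - gamma * beta * b + gamma * (beta * b - gamma * beta * a))
      by (unfold A, alpha1; ring).
    rewrite Hp, Hq; ring. }
  assert (Eb : gamma * a - b = k2 * d / beta).
  { apply eq_div_of_mul_eq; lra. }
  rewrite Eb, Ea, EA.
  apply Rminus_le.
  match goal with |- ?X <= 0 =>
    replace X with (- ((k1 * c - gamma * (k2 * d)) ^ 2 / A)) by (field; lra) end.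
  pose proof (Rcomplements.Rdiv_le_0_compat _ _
                (pow2_ge_0 (k1 * c - gamma * (k2 * d))) Ha).
  lra.
Qed.

(* The slack is [delta h / 8] times the density of the differences
   [a1 - a0, ...], i.e. the gap in [e (mid) <= mid e]. *)
Lemma cell_inequality (rho mu alpha beta gamma h delta n
    a0 a1 b0 b1 c0 c1 d0 d1 a' b' c' d' : R) :
  0 < rho -> 0 < mu -> 0 < beta -> 0 < alpha1 alpha beta gamma ->
  0 < h -> 0 <= delta ->
  a' - (c1 - c0) / h = 0 ->
  b' - (d1 - d0) / h = 0 ->
  rho * c' - alpha * ((a1 - a0) / h) + gamma * beta * ((b1 - b0) / h) = 0 ->
  mu * d' - beta * ((b1 - b0) / h) + gamma * beta * ((a1 - a0) / h) = 0 ->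
  let a := (a0 + a1) / 2 in let b := (b0 + b1) / 2 in
  let c := (c0 + c1) / 2 in let d := (d0 + d1) / 2 in
  h * (rho * c * c' + mu * d * d' + beta * (gamma * a - b) * (gamma * a' - b')
       + alpha1 alpha beta gamma * a * a')
  + delta * h * ((n + 1 / 2) * h)
    * (rho * (c' * a + c * a') + mu * (d' * b + d * b'))
  <= - delta * (h / 2 * density rho mu alpha beta gamma a b c d)
     + (flux alpha beta gamma a1 b1 c1 d1
        + delta / 2 * ((n + 1) * h) * density rho mu alpha beta gamma a1 b1 c1 d1)
     - (flux alpha beta gamma a0 b0 c0 d0
        + delta / 2 * (n * h) * density rho mu alpha beta gamma a0 b0 c0 d0).
Proof.
  intros Hr Hm Hb Ha Hh Hd Ea Eb Ec Ed a b c d.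
  assert (Fa : a' = (c1 - c0) / h) by lra.
  assert (Fb : b' = (d1 - d0) / h) by lra.
  assert (Fc : c' = (alpha * ((a1 - a0) / h) - gamma * beta * ((b1 - b0) / h)) / rho)
    by (apply eq_div_of_mul_eq; lra).
  assert (Fd : d' = (beta * ((b1 - b0) / h) - gamma * beta * ((a1 - a0) / h)) / mu)
    by (apply eq_div_of_mul_eq; lra).
  pose proof (density_ge0 rho mu alpha beta gamma
                (a1 - a0) (b1 - b0) (c1 - c0) (d1 - d0) Hr Hm Hb Ha) as Hpos.
  assert (Hdh : 0 <= delta * h / 8) by (apply Rmult_le_pos; [apply Rmult_le_pos |]; lra).
  pose proof (Rmult_le_pos _ _ Hdh Hpos) as Hslack.
  apply Rminus_le.
  (* With the time derivatives replaced through the equations, the multiplier part is [x_(j+1/2)]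
     times half the difference of the densities at the two nodes. Summation by parts turns it into
     the difference of [x e / 2] minus [h / 2] times the nodal average of [e]. The two sides then
     differ exactly by the slack. *)
  match goal with |- ?X <= 0 =>
    replace X with (- (delta * h / 8 * density rho mu alpha beta gamma
                (a1 - a0) (b1 - b0) (c1 - c0) (d1 - d0))) end.
  - lra.
  - unfold a, b, c, d; rewrite Fa, Fb, Fc, Fd; unfold density, flux, alpha1; field; lra.
Qed.

(** * Finite sums, and right-continuity at time zero *)

Lemma sum_f_R0_telescope (B : nat -> R) (N : nat) :
  sum_f_R0 (fun j => B (S j) - B j) N = B (S N) - B 0%nat.
Proof. induction N as [| N IH]; simpl; [| rewrite IH]; ring. Qed.

Lemma is_derive_sum_f_R0 (f : nat -> R -> R) (f' : nat -> R) (N : nat) (t : R) :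
  (forall j, (j <= N)%nat -> is_derive (f j) t (f' j)) ->
  is_derive (fun s => sum_f_R0 (fun j => f j s) N) t (sum_f_R0 f' N).
Proof.
  induction N as [| N IH]; intros H; simpl; [now apply H |].
  apply (is_derive_plus (V := R_NormedModule)); [| now apply H].
  apply IH; intros j Hj; apply H; lia.
Qed.

(** One-sided, because the equations and the derivatives are available only for positive times; this
    is the link between the evolution and the initial energy. *)
Definition right_continuous_at0 (f : R -> R) : Prop :=
  filterlim f (at_right 0) (locally (f 0)).

Lemma right_continuous_at0_continuous_on (f : R -> R) :
  continuous_on (fun t => 0 <= t) f -> right_continuous_at0 f.
Proof.
  intros H; apply filterlim_filter_le_1 with (2 := H 0 (Rle_refl 0)).
  intros P [e He]; exists e; intros y Hy Hy0; apply He; [exact Hy | lra].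
Qed.

Lemma right_continuous_at0_continuous (f : R -> R) :
  continuous f 0 -> right_continuous_at0 f.
Proof.
  intros H; apply filterlim_filter_le_1 with (2 := H).
  intros P [e He]; exists e; intros y Hy _; now apply He.
Qed.

Lemma right_continuous_at0_const (c : R) : right_continuous_at0 (fun _ => c).
Proof. apply filterlim_const. Qed.

Lemma right_continuous_at0_opp (f : R -> R) :
  right_continuous_at0 f -> right_continuous_at0 (fun t => - f t).
Proof.
  intros Hf; apply (filterlim_comp _ _ _ f Ropp _ _ _ Hf).
  apply (filterlim_opp (V := R_NormedModule)).
Qed.

Lemma right_continuous_at0_plus (f g : R -> R) :
  right_continuous_at0 f -> right_continuous_at0 g ->
  right_continuous_at0 (fun t => f t + g t).
Proof.
  intros Hf Hg; apply (filterlim_comp_2 f g Rplus Hf Hg).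
  apply (filterlim_plus (V := R_NormedModule)).
Qed.

Lemma right_continuous_at0_mult (f g : R -> R) :
  right_continuous_at0 f -> right_continuous_at0 g ->
  right_continuous_at0 (fun t => f t * g t).
Proof.
  intros Hf Hg; apply (filterlim_comp_2 f g Rmult Hf Hg).
  apply (filterlim_mult (K := R_AbsRing)).
Qed.

Lemma right_continuous_at0_sum_f_R0 (f : nat -> R -> R) (N : nat) :
  (forall j, (j <= N)%nat -> right_continuous_at0 (f j)) ->
  right_continuous_at0 (fun s => sum_f_R0 (fun j => f j s) N).
Proof.
  induction N as [| N IH]; intros H; simpl; [now apply H |].
  apply right_continuous_at0_plus; [| now apply H].
  apply IH; intros j Hj; apply H; lia.
Qed.

Lemma right_continuous_at0_mid (u : nat -> R -> R) (j : nat) :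
  right_continuous_at0 (u j) -> right_continuous_at0 (u (S j)) ->
  right_continuous_at0 (fun t => mid (at_time u t) j).
Proof.
  intros H0 H1; apply right_continuous_at0_mult; [| apply right_continuous_at0_const].
  now apply right_continuous_at0_plus.
Qed.

Lemma is_derive_mid (u : nat -> R -> R) (j : nat) (t : R) :
  ex_derive (u j) t -> ex_derive (u (S j)) t ->
  is_derive (fun s => mid (at_time u s) j) t (mid (dot u t) j).
Proof. intros H0 H1; unfold mid, at_time, dot; auto_derive; [tauto | now rewrite !Rmult_1_l]. Qed.

(** * Monotonicity and Gronwall's inequality up to time zero *)

(** The mean value theorem on [[s, t]] with [0 < s] stays away from the origin, where no derivative
    is assumed; then [s] tends to zero from the right. *)
Lemma le_at0_of_derive_nonpos (f f' : R -> R) :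
  right_continuous_at0 f ->
  (forall t, 0 < t -> is_derive f t (f' t)) ->
  (forall t, 0 < t -> f' t <= 0) ->
  forall t, 0 <= t -> f t <= f 0.
Proof.
  intros Hc Hd Hn t [Ht | <-]; [| lra].
  assert (Hdec : forall s, 0 < s < t -> f t <= f s).
  { intros s Hs.
    destruct (MVT_gen f s t f') as (c & Hcst & Eq).
    - intros x Hx; apply Hd; rewrite Rmin_left in Hx; lra.
    - intros x Hx; apply continuity_pt_filterlim, (ex_derive_continuous f x).
      eexists; apply Hd; rewrite Rmin_left in Hx; lra.
    - rewrite Rmin_left, Rmax_right in Hcst by lra.
      pose proof (Hn c ltac:(lra)); nra. }
  apply (filterlim_le (F := at_right 0) (fun _ => f t) f (f t) (f 0)).
  - exists (mkposreal t Ht); intros y Hy Hy0; apply Hdec.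
    apply Rabs_lt_between' in Hy; simpl in Hy; lra.
  - apply filterlim_const.
  - exact Hc.
Qed.

(** The integrating factor [exp (r * t)] turns the differential inequality into monotonicity of the
    product. *)
Lemma gronwall (V V' : R -> R) (r : R) :
  right_continuous_at0 V ->
  (forall t, 0 < t -> is_derive V t (V' t)) ->
  (forall t, 0 < t -> V' t <= - r * V t) ->
  forall t, 0 <= t -> V t <= exp (- r * t) * V 0.
Proof.
  intros Hc Hd Hle t Ht.
  assert (H : exp (r * t) * V t <= exp (r * 0) * V 0).
  { apply (le_at0_of_derive_nonpos (fun s => exp (r * s) * V s)
             (fun s => exp (r * s) * (V' s + r * V s))); [| | | exact Ht].
    - apply right_continuous_at0_mult; [| exact Hc].
      apply right_continuous_at0_continuous.
      apply (ex_derive_continuous (V := R_NormedModule)); auto_derive; exact I.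
    - intros s Hs; pose proof (Hd s Hs) as Hds.
      auto_derive; [eexists; exact Hds |].
      apply is_derive_unique in Hds.
      change (Derive (fun x => V x) s) with (Derive V s); rewrite Hds; ring.
    - intros s Hs; pose proof (Hle s Hs); pose proof (exp_pos (r * s)); nra. }
  rewrite Rmult_0_r, exp_0, Rmult_1_l in H.
  apply Rmult_le_reg_l with (exp (r * t)); [apply exp_pos |].
  rewrite <- Rmult_assoc, <- exp_plus.
  replace (r * t + - r * t) with 0 by ring.
  rewrite exp_0; lra.
Qed.

(** * The perturbed energy: equivalence with the energy and dissipation *)

(** The contribution of one cell to [E + delta F]; the factor [(INR j + 1 / 2) * h] is the midpoint
    [x_(j+1/2)]. *)
Definition lyapunov_cell (rho mu alpha beta gamma h delta : R)
    (u1 u2 w1 w2 : nat -> R -> R) (j : nat) (t : R) : R :=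
  h / 2 * density rho mu alpha beta gamma
            (mid (at_time u1 t) j) (mid (at_time u2 t) j)
            (mid (at_time w1 t) j) (mid (at_time w2 t) j)
  + delta * h * ((INR j + 1 / 2) * h)
    * multiplier rho mu (mid (at_time u1 t) j) (mid (at_time u2 t) j)
        (mid (at_time w1 t) j) (mid (at_time w2 t) j).

(** With [K = h] and [M = delta * h * x_(j+1/2)] the derivative has exactly the shape of the left
    side of [cell_inequality]. *)
Lemma is_derive_quadratic (rho mu alpha beta gamma K M : R) (a b c d : R -> R)
    (t a' b' c' d' : R) :
  is_derive a t a' -> is_derive b t b' -> is_derive c t c' -> is_derive d t d' ->
  is_derive (fun s => K / 2 * density rho mu alpha beta gamma (a s) (b s) (c s) (d s)
                      + M * multiplier rho mu (a s) (b s) (c s) (d s)) t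
    (K * (rho * c t * c' + mu * d t * d'
          + beta * (gamma * a t - b t) * (gamma * a' - b')
          + alpha1 alpha beta gamma * a t * a')
     + M * (rho * (c' * a t + c t * a') + mu * (d' * b t + d t * b'))).
Proof.
  intros Ha Hb Hc Hd; unfold density, multiplier.
  auto_derive.
  - repeat split; eexists; eassumption.
  - apply is_derive_unique in Ha, Hb, Hc, Hd.
    change (Derive (fun x => a x) t) with (Derive a t).
    change (Derive (fun x => b x) t) with (Derive b t).
    change (Derive (fun x => c x) t) with (Derive c t).
    change (Derive (fun x => d x) t) with (Derive d t).
    rewrite Ha, Hb, Hc, Hd; field.
Qed.

Lemma energy_density (L rho mu alpha beta gamma : R) (N : nat)
    (u1 u2 w1 w2 : nat -> R -> R) (t : R) :
  energy L rho mu alpha beta gamma N u1 u2 w1 w2 t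
  = sum_f_R0 (fun j => mesh L N / 2 * density rho mu alpha beta gamma
      (mid (at_time u1 t) j) (mid (at_time u2 t) j)
      (mid (at_time w1 t) j) (mid (at_time w2 t) j)) N.
Proof.
  unfold energy; rewrite scal_sum; apply sum_eq; intros j _.
  rewrite !pow2_abs; unfold density; ring.
Qed.

(** The difference is [delta F]. It is bounded cell by cell through [multiplier_bound], with every
    midpoint lying between 0 and [L]. *)
Lemma lyapunov_equiv_energy (L rho mu alpha beta gamma delta : R) (N : nat)
    (u1 u2 w1 w2 : nat -> R -> R) (t : R) :
  0 < L -> 0 < rho -> 0 < mu -> 0 < beta -> 0 < gamma ->
  0 < alpha1 alpha beta gamma -> 0 <= delta ->
  Rabs (sum_f_R0 (fun j => lyapunov_cell rho mu alpha beta gamma (mesh L N) delta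
                              u1 u2 w1 w2 j t) N
        - energy L rho mu alpha beta gamma N u1 u2 w1 w2 t)
  <= delta * L * eta rho mu alpha beta gamma
     * energy L rho mu alpha beta gamma N u1 u2 w1 w2 t.
Proof.
  intros HL Hr Hm Hb Hg Ha Hd.
  assert (HN : 0 < INR (N + 1)) by (apply lt_0_INR; lia).
  assert (Hh : 0 < mesh L N) by (apply Rdiv_lt_0_compat; lra).
  rewrite energy_density, <- minus_sum, scal_sum.
  eapply Rle_trans; [apply Rsum_abs |].
  apply sum_Rle; intros j Hj.
  unfold lyapunov_cell.
  pose proof (multiplier_bound rho mu alpha beta gamma
    (mid (at_time u1 t) j) (mid (at_time u2 t) j)
    (mid (at_time w1 t) j) (mid (at_time w2 t) j) Hr Hm Hb Hg Ha) as Hmb.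
  set (e := density _ _ _ _ _ _ _ _ _) in *.
  set (m := multiplier _ _ _ _ _ _) in *.
  set (h := mesh L N) in *.
  replace (h / 2 * e + delta * h * ((INR j + 1 / 2) * h) * m - h / 2 * e)
    with (delta * h * ((INR j + 1 / 2) * h) * m) by ring.
  assert (HjN : INR j + 1 <= INR (N + 1)) by (rewrite <- S_INR; apply le_INR; lia).
  assert (EL : INR (N + 1) * h = L) by (unfold h, mesh; field; lra).
  pose proof (pos_INR j) as Hj0.
  assert (Hx0 : 0 <= (INR j + 1 / 2) * h) by (apply Rmult_le_pos; lra).
  assert (HxL : (INR j + 1 / 2) * h <= L)
    by (rewrite <- EL; apply Rmult_le_compat_r; lra).
  assert (Hdh : 0 <= delta * h) by (apply Rmult_le_pos; lra).
  rewrite Rabs_mult, (Rabs_pos_eq (delta * h * _)) by (apply Rmult_le_pos; lra).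
  apply Rle_trans with (delta * h * L * (eta rho mu alpha beta gamma / 2 * e)).
  - apply Rmult_le_compat; [apply Rmult_le_pos; lra | apply Rabs_pos | | exact Hmb].
    apply Rmult_le_compat_l; lra.
  - apply Req_le; field.
Qed.

Lemma lyapunov_right_continuous_at0 (rho mu alpha beta gamma h delta : R) (N : nat)
    (u1 u2 w1 w2 : nat -> R -> R) :
  regular N u1 -> regular N u2 -> regular N w1 -> regular N w2 ->
  right_continuous_at0 (fun t => sum_f_R0 (fun j =>
    lyapunov_cell rho mu alpha beta gamma h delta u1 u2 w1 w2 j t) N).
Proof.
  intros R1 R2 R3 R4; apply right_continuous_at0_sum_f_R0; intros j Hj.
  assert (Hmid : forall u, regular N u ->
            right_continuous_at0 (fun t => mid (at_time u t) j)).
  { intros u Hu; apply right_continuous_at0_mid;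
      apply right_continuous_at0_continuous_on, Hu; lia. }
  pose proof (Hmid _ R1); pose proof (Hmid _ R2);
    pose proof (Hmid _ R3); pose proof (Hmid _ R4).
  unfold lyapunov_cell, density, multiplier, Rminus; simpl pow.
  repeat first
    [ apply right_continuous_at0_const
    | assumption
    | apply right_continuous_at0_plus
    | apply right_continuous_at0_mult
    | apply right_continuous_at0_opp ].
Qed.

(** Summing [cell_inequality] leaves [- delta E] plus the boundary difference of [B]. At the right
    end the feedback laws turn the flux into [- k1 w1^2 - k2 w2^2], which absorbs the boundary
    density thanks to the two smallness conditions. *)
Lemma lyapunov_dissipation (L rho mu alpha beta gamma k1 k2 delta : R) (N : nat)
    (u1_0 u2_0 w1_0 w2_0 : nat -> R) (u1 u2 w1 w2 : nat -> R -> R) (t : R) :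
  0 < L -> 0 < rho -> 0 < mu -> 0 < beta ->
  0 < alpha1 alpha beta gamma -> 0 <= delta ->
  delta * L / 2 * (rho + 2 * k1 ^ 2 / alpha1 alpha beta gamma) <= k1 ->
  delta * L / 2 * (mu + (alpha + gamma ^ 2 * beta) * k2 ^ 2
                        / (beta * alpha1 alpha beta gamma)) <= k2 ->
  is_solution L rho mu alpha beta gamma k1 k2 N
    u1_0 u2_0 w1_0 w2_0 u1 u2 w1 w2 ->
  0 < t ->
  exists l, is_derive (fun s => sum_f_R0 (fun j =>
      lyapunov_cell rho mu alpha beta gamma (mesh L N) delta u1 u2 w1 w2 j s) N) t l
    /\ l <= - delta * energy L rho mu alpha beta gamma N u1 u2 w1 w2 t.
Proof.
  intros HL Hr Hm Hb Ha Hd Hk1 Hk2 S Ht.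
  destruct (sol_regular _ _ _ _ _ _ _ _ _ _ _ _ _ _ _ _ _ S) as (R1 & R2 & R3 & R4).
  assert (HN : 0 < INR (N + 1)) by (apply lt_0_INR; lia).
  assert (Hh : 0 < mesh L N) by (apply Rdiv_lt_0_compat; lra).
  assert (Hmid : forall u j, regular N u -> (j <= N)%nat ->
            is_derive (fun s => mid (at_time u s) j) t (mid (dot u t) j)).
  { intros u j Hu Hj; apply is_derive_mid; apply Hu; auto; lia. }
  eexists; split.
  - apply is_derive_sum_f_R0; intros j Hj.
    apply is_derive_quadratic; apply Hmid; assumption.
  - set (B := fun j => flux alpha beta gamma (u1 j t) (u2 j t) (w1 j t) (w2 j t)
           + delta / 2 * (INR j * mesh L N)
             * density rho mu alpha beta gamma (u1 j t) (u2 j t) (w1 j t) (w2 j t)).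
    apply Rle_trans with (- delta * energy L rho mu alpha beta gamma N u1 u2 w1 w2 t
                          + (B (Datatypes.S N) - B 0%nat)).
    + rewrite <- sum_f_R0_telescope, energy_density, scal_sum, <- plus_sum.
      apply sum_Rle; intros j Hj.
      eapply Rle_trans.
      * apply (cell_inequality rho mu alpha beta gamma (mesh L N) delta (INR j)
                 (u1 j t) (u1 (Datatypes.S j) t) (u2 j t) (u2 (Datatypes.S j) t)
                 (w1 j t) (w1 (Datatypes.S j) t) (w2 j t) (w2 (Datatypes.S j) t));
          try assumption.
        -- apply (sol_eq_u1 _ _ _ _ _ _ _ _ _ _ _ _ _ _ _ _ _ S); assumption.
        -- apply (sol_eq_u2 _ _ _ _ _ _ _ _ _ _ _ _ _ _ _ _ _ S); assumption.
        -- apply (sol_eq_w1 _ _ _ _ _ _ _ _ _ _ _ _ _ _ _ _ _ S); assumption.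
        -- apply (sol_eq_w2 _ _ _ _ _ _ _ _ _ _ _ _ _ _ _ _ _ S); assumption.
      * apply Req_le; unfold B, mid, at_time; rewrite S_INR; ring.
    + destruct (sol_left _ _ _ _ _ _ _ _ _ _ _ _ _ _ _ _ _ S t Ht) as [W1 W2].
      pose proof (sol_right1 _ _ _ _ _ _ _ _ _ _ _ _ _ _ _ _ _ S t Ht) as P1.
      pose proof (sol_right2 _ _ _ _ _ _ _ _ _ _ _ _ _ _ _ _ _ S t Ht) as P2.
      pose proof (boundary_density_le rho mu _ _ _ _ _ _ _ _ _ Hb Ha P1 P2) as Hbd.
      (* At the left end the flux vanishes with the velocities, and the density term vanishes
         because its weight is [x_0 = 0]. *)
      assert (B0 : B 0%nat = 0) by (unfold B, flux; rewrite W1, W2; simpl; ring).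
      assert (BN : B (Datatypes.S N) <= 0); [| lra].
      unfold B, flux; rewrite <- Nat.add_1_r, P1, P2.
      replace (INR (N + 1) * mesh L N) with L by (unfold mesh; field; lra).
      assert (HdL : 0 <= delta / 2 * L) by (apply Rmult_le_pos; lra).
      pose proof (Rmult_le_compat_l _ _ _ HdL Hbd).
      pose proof (Rmult_le_compat_r _ _ _ (pow2_ge_0 (w1 (N + 1)%nat t)) Hk1).
      pose proof (Rmult_le_compat_r _ _ _ (pow2_ge_0 (w2 (N + 1)%nat t)) Hk2).
      lra.
Qed.

(** * Smallness of [delta] and the decay estimate *)

Lemma le_of_lt_div_half (L delta x y : R) :
  0 < L -> 0 < y -> delta < 1 / (2 * L) * (x / y) -> 2 * L * delta * y < x.
Proof.
  intros HL Hy H.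
  apply Rmult_lt_compat_r with (r := 2 * L * y) in H; [| nra].
  replace (1 / (2 * L) * (x / y) * (2 * L * y)) with x in H by (field; lra).
  lra.
Qed.

Theorem theorem3p6
  (L rho mu alpha beta gamma k1 k2 delta : R)
  (HL : 0 < L) (Hrho : 0 < rho) (Hmu : 0 < mu)
  (Halpha : 0 < alpha) (Hbeta : 0 < beta) (Hgamma : 0 < gamma)
  (Halpha1 : 0 < alpha1 alpha beta gamma)
  (Hk1 : 0 < k1) (Hk2 : 0 < k2) (Hdelta : 0 < delta)
  (Hdelta_lt :
     delta < 1 / (2 * L) *
       Rmin (1 / eta rho mu alpha beta gamma)
         (Rmin (2 * k1 * alpha1 alpha beta gamma
                  / (alpha1 alpha beta gamma * rho + k1 ^ 2))
               (4 * k2 * beta * alpha1 alpha beta gamma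
                  / (2 * alpha1 alpha beta gamma * beta * mu
                     + (alpha + gamma ^ 2 * beta) * k2 ^ 2)))) :
  forall (N : nat) (u1_0 u2_0 w1_0 w2_0 : nat -> R)
         (u1 u2 w1 w2 : nat -> R -> R),
    is_solution L rho mu alpha beta gamma k1 k2 N
      u1_0 u2_0 w1_0 w2_0 u1 u2 w1 w2 ->
    forall t : R, 0 <= t ->
      energy L rho mu alpha beta gamma N u1 u2 w1 w2 t
      <= (1 + delta * L * eta rho mu alpha beta gamma)
           / (1 - delta * L * eta rho mu alpha beta gamma)
         * exp (- delta * (1 - delta * L * eta rho mu alpha beta gamma) * t)
         * energy L rho mu alpha beta gamma N u1 u2 w1 w2 0.
Proof.
  intros N u1_0 u2_0 w1_0 w2_0 u1 u2 w1 w2 S t Ht.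
  pose proof (eta_gt0 rho mu alpha beta gamma Hrho Halpha1) as Heta.
  assert (H2L : 0 < 1 / (2 * L)) by (apply Rdiv_lt_0_compat; lra).
  set (A := alpha1 alpha beta gamma) in *.
  set (Eta := eta rho mu alpha beta gamma) in *.
  assert (HAr : 0 < A * rho) by (apply Rmult_lt_0_compat; lra).
  assert (HAb : 0 < A * beta) by (apply Rmult_lt_0_compat; lra).
  assert (HAbm : 0 < A * beta * mu) by (apply Rmult_lt_0_compat; lra).
  assert (Hag : 0 < alpha + gamma ^ 2 * beta)
    by (pose proof (Rmult_le_pos _ _ (pow2_ge_0 gamma) (Rlt_le _ _ Hbeta)); lra).
  pose proof (Rmult_le_pos _ _ (Rlt_le _ _ Hag) (pow2_ge_0 k2)) as Hagk.
  pose proof (pow2_ge_0 k1) as Hk1sq.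
  assert (Hmin : forall m, Rmin (1 / Eta) (Rmin (2 * k1 * A / (A * rho + k1 ^ 2))
      (4 * k2 * beta * A / (2 * A * beta * mu + (alpha + gamma ^ 2 * beta) * k2 ^ 2)))
      <= m -> delta < 1 / (2 * L) * m).
  { intros m Hle; eapply Rlt_le_trans; [exact Hdelta_lt |].
    apply Rmult_le_compat_l; lra. }
  (* The three entries of the minimum, with denominators cleared. The first gives
     [delta * L * Eta < 1 / 2]; the other two lead to the boundary conditions of
     [lyapunov_dissipation]. *)
  pose proof (le_of_lt_div_half L delta _ _ HL Heta (Hmin _ (Rmin_l _ _))) as D1.
  assert (D2 : 2 * L * delta * (A * rho + k1 ^ 2) < 2 * k1 * A).
  { apply le_of_lt_div_half; [exact HL | lra | apply Hmin].
    eapply Rle_trans; [apply Rmin_r | apply Rmin_l]. }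
  assert (D3 : 2 * L * delta * (2 * A * beta * mu + (alpha + gamma ^ 2 * beta) * k2 ^ 2)
               < 4 * k2 * beta * A).
  { apply le_of_lt_div_half; [exact HL | lra | apply Hmin].
    eapply Rle_trans; [apply Rmin_r | apply Rmin_r]. }
  assert (HLd : 0 < L * delta) by (apply Rmult_lt_0_compat; lra).
  (* Multiplied by [2 * A], the left side falls short of that of [D2] by the positive term
     [L * delta * A * rho]. The same happens below with [D3], the factor [4 * A * beta] and a term
     in [mu]. *)
  assert (C1 : delta * L / 2 * (rho + 2 * k1 ^ 2 / A) <= k1).
  { apply Rmult_le_reg_r with (2 * A); [lra |].
    replace (delta * L / 2 * (rho + 2 * k1 ^ 2 / A) * (2 * A))
      with (L * delta * (A * rho) + 2 * L * delta * k1 ^ 2) by (field; lra).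
    pose proof (Rmult_lt_0_compat _ _ HLd HAr); lra. }
  assert (C2 : delta * L / 2 * (mu + (alpha + gamma ^ 2 * beta) * k2 ^ 2 / (beta * A)) <= k2).
  { apply Rmult_le_reg_r with (4 * (A * beta)); [lra |].
    replace (delta * L / 2 * (mu + (alpha + gamma ^ 2 * beta) * k2 ^ 2 / (beta * A))
             * (4 * (A * beta)))
      with (2 * (L * delta * (A * beta * mu))
            + 2 * L * delta * ((alpha + gamma ^ 2 * beta) * k2 ^ 2)) by (field; lra).
    pose proof (Rmult_lt_0_compat _ _ HLd HAbm); lra. }
  set (V := fun s => sum_f_R0 (fun j =>
    lyapunov_cell rho mu alpha beta gamma (mesh L N) delta u1 u2 w1 w2 j s) N).
  set (E := energy L rho mu alpha beta gamma N u1 u2 w1 w2).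
  set (th := delta * L * Eta).
  assert (Hth0 : 0 < th) by (unfold th; rewrite (Rmult_comm delta L); now apply Rmult_lt_0_compat).
  assert (Hth1 : th < 1) by (unfold th; lra).
  assert (HVE : forall s, Rabs (V s - E s) <= th * E s)
    by (intros s; apply lyapunov_equiv_energy; try assumption; lra).
  assert (Hlow : forall s, (1 - th) * E s <= V s)
    by (intros s; pose proof (HVE s) as H; apply Rabs_le_between in H; lra).
  assert (Hup : forall s, V s <= (1 + th) * E s)
    by (intros s; pose proof (HVE s) as H; apply Rabs_le_between in H; lra).
  (* The equivalence itself gives the sign: [0 <= Rabs (V s - E s) <= th * E s] with [th]
     positive. *)
  assert (HE0 : forall s, 0 <= E s).
  { intros s; pose proof (Rabs_pos (V s - E s)); pose proof (HVE s).
    apply Rmult_le_reg_l with th; lra. }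
  assert (Hdiss : forall s, 0 < s -> exists l, is_derive V s l /\ l <= - delta * E s).
  { intros s Hs.
    apply (lyapunov_dissipation L rho mu alpha beta gamma k1 k2 delta N
             u1_0 u2_0 w1_0 w2_0 u1 u2 w1 w2 s); try assumption; lra. }
  assert (HV : V t <= exp (- (delta * (1 - th)) * t) * V 0).
  { apply gronwall with (V' := Derive V); [| | | exact Ht].
    - destruct (sol_regular _ _ _ _ _ _ _ _ _ _ _ _ _ _ _ _ _ S) as (R1 & R2 & R3 & R4).
      now apply lyapunov_right_continuous_at0.
    - intros s Hs; destruct (Hdiss s Hs) as (l & Hl & _).
      apply Derive_correct; now exists l.
    - intros s Hs; destruct (Hdiss s Hs) as (l & Hl & Hle).
      rewrite (is_derive_unique _ _ _ Hl).
      (* [(1 - th) V <= (1 - th) (1 + th) E <= E] *)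
      assert (H1 : (1 - th) * V s <= (1 - th) * ((1 + th) * E s))
        by (apply Rmult_le_compat_l; [lra | apply Hup]).
      pose proof (Rmult_le_pos _ _ (Rle_0_sqr th) (HE0 s)) as H2; unfold Rsqr in H2.
      assert (H3 : delta * ((1 - th) * V s) <= delta * E s)
        by (apply Rmult_le_compat_l; lra).
      lra. }
  (* The energy is sandwiched: [(1 - th) E(t) <= V(t)], Gronwall carries [V] back to time zero, and
     [V(0) <= (1 + th) E(0)]. *)
  apply Rmult_le_reg_l with (1 - th); [lra |].
  apply Rle_trans with (1 := Hlow t), Rle_trans with (1 := HV).
  replace (- delta * (1 - th) * t) with (- (delta * (1 - th)) * t) by ring.
  apply Rle_trans with (exp (- (delta * (1 - th)) * t) * ((1 + th) * E 0)).
  - apply Rmult_le_compat_l; [apply Rlt_le, exp_pos | apply Hup].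
  - apply Req_le; field; lra.
Qed.
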